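(* Let $p$ be one of the primes $5, 7, 11, 13, 17, 19, 23, 29, 31, 37, 41, 43, 61, 67, 71$ (for each of which $\mathbb{Q}(\zeta_{p-1})$ has class number $1$), and let $\mathfrak{P}$ be a prime ideal over $p$ in the ring of integers of $\mathbb{Q}(\zeta_{p-1})$. Then $\mathfrak{P}$ is large if and only if $p\in\{5,7,11,13,19,31\}$.
   Context: $\zeta_m$ denotes a primitive $m$-th root of unity. For a number field $K$, an element $x\in\mathcal{O}_K$ is large if $|\sigma(x)|\ge1$ for every embedding $\sigma:K\to\mathbb{C}$; an ideal of $\mathcal{O}_K$ is large if it is principal and has a large generator. *)

(* Defs.v *)
From HB Require Import structures.
From mathcomp Require Import all_boot all_order all_algebra all_field.
From mathcomp Require Import boolp classical_sets reals complex.

Set Implicit Arguments.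
Unset Strict Implicit.
Unset Printing Implicit Defensive.

Import Order.TTheory GRing.Theory Num.Theory.

Local Open Scope ring_scope.

(* Number fields are the finite extensions of rat, K : fieldExtType rat. *)

Definition is_alg_int (K : fieldExtType rat) : {pred K} :=
  fun x => `[< integralOver (intr : int -> K) x >].

Lemma is_alg_int_subring (K : fieldExtType rat) :
  subring_closed (@is_alg_int K).
Proof.
split=> [|x y /asboolP hx /asboolP hy|x y /asboolP hx /asboolP hy];
  apply/asboolP.
- exact: integral1.
- exact: integral_sub.
- exact: integral_mul.
Qed.

HB.instance Definition _ (K : fieldExtType rat) :=
  GRing.isSubringClosed.Build K (@is_alg_int K) (@is_alg_int_subring K).

Record ringOfIntegers (K : fieldExtType rat) := RingOfIntegers {
  int_val : K;
  int_valP : int_val \in @is_alg_int K }.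

HB.instance Definition _ (K : fieldExtType rat) :=
  [isSub for @int_val K].
HB.instance Definition _ (K : fieldExtType rat) :=
  [Choice of ringOfIntegers K by <:].
HB.instance Definition _ (K : fieldExtType rat) :=
  [SubChoice_isSubComNzRing of ringOfIntegers K by <:].

Notation "''O_' K" := (ringOfIntegers K)
  (at level 8, K at level 2, format "''O_' K") : type_scope.

(* The field of complex numbers is R[i] for R : realType; its norm is
   R[i]-valued, and its order extends that of R. *)
Definition large_elt (R : realType) (K : fieldExtType rat) (x : 'O_K) : Prop :=
  forall sigma : {rmorphism K -> R[i]}, 1 <= `|sigma (val x)|.

Definition generates (A : comNzRingType) (x : A) (I : {pred A}) : Prop :=
  forall y : A, y \in I <-> exists a : A, y = a * x.

Definition large_ideal (R : realType) (K : fieldExtType rat)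
    (I : {pred 'O_K}) : Prop :=
  exists2 x : 'O_K, generates x I & large_elt R x.

Definition lies_over (K : fieldExtType rat) (P : {pred 'O_K}) (p : nat) : Prop :=
  forall m : int, (m%:~R \in P) = (p %| m)%Z.

Definition cyclotomic_field (n : nat) (K : fieldExtType rat) : Prop :=
  exists2 z : K, n.-primitive_root z & <<1; z>>%VS = fullv.

(* Main.v *)
Require Import Defs.
From HB Require Import structures.
From mathcomp Require Import all_boot all_order all_fingroup all_algebra all_solvable all_field.
From mathcomp Require Import boolp reals complex ring.

Set Implicit Arguments.
Unset Strict Implicit.
Unset Printing Implicit Defensive.

Import Order.TTheory GRing.Theory Num.Theory.

Local Open Scope ring_scope.

(* If [x] generates the prime ideal, then [zeta - r] is in the ideal for some choice of
   [zeta] and some primitive root [r] modulo [p], the conjugates of [x] are pairwise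
   comaximal divisors of [p], and the norm of [x] is [p] up to sign. Let [a] run over the
   squared absolute values of the conjugates of [x]. The products of the [a - 1] and of the
   [a - 2] are norms of [x * xbar - 1] and [x * xbar - 2], hence nonzero integers, so the
   inequality [108 (a-1)^2 (a-2)^2 <= a^6], valid for [1 <= a], gives
   [108 ^ totient (p-1) <= p ^ 12]. This fails for the nine primes that are not listed.
   (Using [a - 1] alone would give [2 ^ totient (p-1) <= p ^ 2], which does not exclude 17.)
   For the six others, a large generator is [2 - zeta], [2 + zeta] or
   [1 + zeta - zeta ^ 2]. *)

(** * Embeddings of a cyclotomic field *)

(** ['X^n - 1] is the product of the ['Phi_d] with [d] dividing [n], so some factor vanishes at [w];
    since ['Phi_d] divides ['X^d - 1], that factor has [d = n]. *)
Lemma root_Cyclotomic (F : fieldType) n (w : F) :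
  n.-primitive_root w -> root (map_poly intr 'Phi_n) w.
Proof.
move=> wn; have n_gt0 := prim_order_gt0 wn.
have: root (map_poly intr (\prod_(d <- divisors n) 'Phi_d)) w.
  rewrite prod_Cyclotomic // rmorphB rmorph1 /= map_polyXn.
  by rewrite rootE !hornerE prim_expr_order ?subrr.
rewrite rmorph_prod -(big_map _ predT id) /=; apply: contraTT => Phi_nw.
rewrite root_bigmul all_map; apply/allP => d.
rewrite -dvdn_divisors //= => dvdn; apply: contra Phi_nw => Phi_dw.
have d_gt0 : (0 < d)%N by apply: dvdn_gt0 dvdn.
suff : w ^+ d == 1.
  by rewrite -(prim_order_dvd wn) => nd; have /eqP <- : d == n by rewrite eqn_dvd dvdn.
rewrite -subr_eq0.
have : (map_poly intr ('X^d - 1 : {poly int})).[w] = 0 :> F.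
  rewrite -prod_Cyclotomic // (big_rem d) -?dvdn_divisors //=.
  by rewrite rmorphM hornerM (rootP Phi_dw) mul0r.
by rewrite rmorphB rmorph1 /= map_polyXn !hornerE => ->.
Qed.

Definition ratPhi n : {poly rat} := map_poly intr 'Phi_n.

Lemma size_ratPhi n : size (ratPhi n) = (totient n).+1.
Proof. by rewrite size_map_inj_poly ?size_Cyclotomic //; apply: intr_inj. Qed.

Lemma map_ratPhi (F : nzRingType) (j : {rmorphism rat -> F}) n :
  map_poly j (ratPhi n) = map_poly intr 'Phi_n.
Proof. by rewrite -map_poly_comp; apply: eq_map_poly => a /=; rewrite rmorph_int. Qed.

(** Irreducibility of ['Phi_n] is carried over from [algC]: the gcd of [q] and [ratPhi n] vanishes
    at [w], so it is not constant and has a root in [algC]. That root is a primitive [n]-th root of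
    unity, with minimal polynomial [ratPhi n]. *)
Lemma root_prim_rat (F : fieldType) (j : {rmorphism rat -> F}) n (w : F) q :
  n.-primitive_root w -> root (map_poly j q) w = (ratPhi n %| q).
Proof.
move=> wn; have n_gt0 := prim_order_gt0 wn.
have Phi_w : root (map_poly j (ratPhi n)) w by rewrite map_ratPhi root_Cyclotomic.
apply/idP/idP => [qw|/dvdpP[r ->]]; last by rewrite rmorphM rootM Phi_w orbT.
have [z0 z0n] := C_prim_root_exists n_gt0.
have Phi_neq0 : ratPhi n != 0 by rewrite -size_poly_gt0 size_ratPhi.
have [x gx] : exists x : algC, root (map_poly ratr (gcdp q (ratPhi n))) x.
  apply/closed_rootP; rewrite size_map_poly -(size_map_poly j) gtn_eqF //.
  apply: (@root_size_gt1 _ w); last by rewrite gcdp_map root_gcd qw.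
  by rewrite map_poly_eq0 gcdp_eq0 negb_and Phi_neq0 orbT.
have {gx} /andP[qx Phi_x] : root (map_poly ratr q) x && root (map_poly ratr (ratPhi n)) x.
  by rewrite -root_gcd -gcdp_map.
have xn : n.-primitive_root x.
  by rewrite -(root_cyclotomic z0n) -(Cintr_Cyclotomic z0n) -(map_ratPhi ratr).
have [f [Df _] f_min] := minCpolyP x.
suff <- : f = ratPhi n by rewrite -f_min.
apply: (map_inj_poly (fmorph_inj (ratr : rat -> algC)) (rmorph0 _)).
by rewrite -[LHS]Df (minCpoly_cyclotomic xn) map_ratPhi (Cintr_Cyclotomic xn).
Qed.

Section Embeddings.
Variables (K : fieldExtType rat) (n : nat) (z : K).
Hypotheses (zn : n.-primitive_root z) (gen_z : <<1; z>>%VS = fullv).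

Lemma primitive_element_poly x :
  exists2 q : {poly rat}, (size q <= totient n)%N & x = (map_poly (in_alg K) q).[z].
Proof.
have /Fadjoin1_polyP[q xq] : x \in <<1; z>>%VS by rewrite gen_z memvf.
exists (q %% ratPhi n).
  by rewrite -ltnS -size_ratPhi ltn_modp -size_poly_gt0 size_ratPhi.
rewrite xq {1}(divp_eq q (ratPhi n)) rmorphD rmorphM /= hornerD hornerM.
by rewrite (map_ratPhi (in_alg K)) (rootP (root_Cyclotomic zn)) mulr0 add0r.
Qed.

(** Sending [q.[z]] to [q.[w]] is well defined: polynomials with the same value at [z] differ by a
    multiple of [ratPhi n], which vanishes at [w]. *)
Lemma ex_rmorph_root (F : fieldType) (j : {rmorphism rat -> F}) (w : F) :
  root (map_poly intr 'Phi_n) w -> exists f : {rmorphism K -> F}, f z = w.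
Proof.
move=> Phi_w.
have ex_q x : exists q : {poly rat}, x = (map_poly (in_alg K) q).[z].
  by have [q _ ->] := primitive_element_poly x; exists q.
have [Q QE] := choice ex_q.
pose f x := (map_poly j (Q x)).[w].
have fE q : f (map_poly (in_alg K) q).[z] = (map_poly j q).[w].
  apply/eqP; rewrite -subr_eq0 -hornerN -hornerD -rmorphN -rmorphD /=.
  have : ratPhi n %| Q (map_poly (in_alg K) q).[z] - q.
    by rewrite -(root_prim_rat (in_alg K) _ zn) rootE rmorphB /= hornerD hornerN -QE subrr.
  case/dvdpP => r ->.
  by rewrite rmorphM /= hornerM (map_ratPhi j) (rootP Phi_w) mulr0.
have fB : zmod_morphism f.
  by move=> x y; rewrite (QE x) (QE y) -hornerN -hornerD -rmorphB !fE rmorphB /= hornerD hornerN.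
have fM : monoid_morphism f.
  split=> [|x y]; last by rewrite (QE x) (QE y) -hornerM -rmorphM !fE rmorphM /= hornerM.
  by have := fE 1; rewrite !rmorph1 -!polyC1 !hornerC.
pose g : {rmorphism K -> F} :=
  HB.pack f (GRing.isZmodMorphism.Build K F f fB) (GRing.isMonoidMorphism.Build K F f fM).
exists g; have := fE 'X; rewrite !map_polyX !hornerX; exact.
Qed.

Lemma eq_rmorph_prim (F : fieldType) (f g : {rmorphism K -> F}) :
  f z = g z -> f =1 g.
Proof.
move=> fg x; have [q _ ->] := primitive_element_poly x.
rewrite -!horner_map /= fg -!map_poly_comp; congr (_.[_]).
by apply: eq_map_poly => a /=; rewrite alg_num_field !fmorph_rat.
Qed.

End Embeddings.

(** * Conjugates of algebraic integers *)

Lemma alg_int_rmorph (K : fieldExtType rat) (f : {rmorphism K -> K}) (x : K) :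
  x \in @is_alg_int K -> f x \in @is_alg_int K.
Proof.
move=> /asboolP[q mon_q qx]; apply/asboolP; exists q => //.
suff -> : map_poly intr q = map_poly f (map_poly intr q) :> {poly K} by rewrite fmorph_root.
by rewrite -map_poly_comp; apply: eq_map_poly => a /=; rewrite rmorph_int.
Qed.

Section IntegerMap.
Variables (K : fieldExtType rat) (f : {rmorphism K -> K}).

Definition int_map (x : 'O_K) : 'O_K :=
  RingOfIntegers (alg_int_rmorph f (int_valP x)).

Fact int_map_zmod_morphism : zmod_morphism int_map.
Proof. by move=> x y; apply: val_inj; rewrite /= !rmorphB. Qed.

Fact int_map_monoid_morphism : monoid_morphism int_map.
Proof. by split=> [|x y]; apply: val_inj; rewrite /= ?rmorph1 ?rmorphM. Qed.

HB.instance Definition _ :=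
  GRing.isZmodMorphism.Build 'O_K 'O_K int_map int_map_zmod_morphism.
HB.instance Definition _ :=
  GRing.isMonoidMorphism.Build 'O_K 'O_K int_map int_map_monoid_morphism.

End IntegerMap.

Lemma unity_root_alg_int (K : fieldExtType rat) n (z : K) :
  (0 < n)%N -> z ^+ n = 1 -> z \in @is_alg_int K.
Proof.
move=> n_gt0 zn; apply/asboolP; exists ('X^n - 1); first exact: monicXnsubC.
by rewrite rmorphB rmorph1 /= map_polyXn rootE !hornerE zn subrr.
Qed.

(** The monic equation of [x] is carried to [algC], where rational algebraic integers are known to
    be integers. *)
Lemma rat_alg_int (K : fieldExtType rat) (x : 'O_K) (a : rat) :
  val x = a%:A -> exists m : int, x = m%:~R.
Proof.
move=> xa; have /asboolP[q mon_q qx] := int_valP x.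
have qa : root (map_poly intr q) a.
  rewrite -(fmorph_root (in_alg K)) -map_poly_comp -[X in root _ X]xa.
  by congr root: qx; apply: eq_map_poly => b /=; rewrite -in_algE rmorph_int.
have : (ratr a : algC) \in Aint.
  apply: (@root_monic_Aint (map_poly intr q)); last by apply/polyOverP => i; rewrite coef_map /= intr_int.
    rewrite -(fmorph_root (ratr : rat -> algC)) -map_poly_comp in qa.
    by congr root: qa; apply: eq_map_poly => b /=; rewrite rmorph_int.
  by rewrite monic_map.
move/(Cint_rat_Aint (Crat_rat a)); case/intrP => m am; exists m; apply: val_inj; rewrite xa rmorph_int.
have -> : a = m%:~R by apply: (fmorph_inj (ratr : rat -> algC)); rewrite [LHS]am rmorph_int.
by rewrite -in_algE rmorph_int.
Qed.

Section Conjugates.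
Variables (K : fieldExtType rat) (n : nat) (z : K).
Hypotheses (n_gt1 : (1 < n)%N) (zn : n.-primitive_root z) (gen_z : <<1; z>>%VS = fullv).

(** The units modulo [n] index the Galois group. The bound [1 < n] matters because ['Z_n] has [n]
    elements only then. *)
Lemma ex_conj : exists s : {unit 'Z_n} -> {rmorphism K -> K},
  forall u, s u z = z ^+ val u.
Proof.
suff /choice[s sz] : forall u : {unit 'Z_n}, exists f : {rmorphism K -> K}, f z = z ^+ val u.
  by exists s.
move=> u; apply: (ex_rmorph_root zn gen_z (in_alg K)); apply: root_Cyclotomic.
rewrite (prim_root_exp_coprime _ zn) coprime_sym -unitZpE // natr_Zp.
exact: valP u.
Qed.

Variable s : {unit 'Z_n} -> {rmorphism K -> K}.
Hypothesis sz : forall u, s u z = z ^+ val u.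

Lemma conjM u v x : s u (s v x) = s (u * v)%g x.
Proof.
apply: (@eq_rmorph_prim _ _ _ zn gen_z _ (s u \o s v)) => /=.
rewrite !sz rmorphXn /= sz -exprM -(prim_expr_mod zn) //; congr (_ ^+ _).
by congr (_ %% _)%N; exact/esym/Zp_cast.
Qed.

Lemma conj1 x : s 1%g x = x.
Proof.
apply: (@eq_rmorph_prim _ _ _ zn gen_z _ (s 1%g) idfun) => /=.
by rewrite sz /= modn_small ?expr1.
Qed.

Lemma conj_inj u v : s u z = s v z -> u = v.
Proof.
rewrite !sz => /eqP; rewrite (eq_prim_root_expr zn) => uv.
have lt_n (w : {unit 'Z_n}) : (val w < n)%N by apply: leq_trans (ltn_ord (val w)) _; rewrite Zp_cast.
by apply/val_inj/val_inj/eqP; move: uv; rewrite !modn_small.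
Qed.

Lemma card_conj : #|{: {unit 'Z_n}}| = totient n.
Proof. by rewrite -card_units_Zp 1?ltnW //= /units_Zp cardsT. Qed.

(** Write [x = q.[z]] with [size q <= totient n]. Then [q - x] vanishes at the [totient n] distinct
    conjugates of [z], so it is zero and [x] is the constant coefficient of [q]. *)
Lemma conj_fixed (x : K) : (forall u, s u x = x) -> exists a : rat, x = a%:A.
Proof.
move=> fx; have [q sz_q xq] := primitive_element_poly zn gen_z x.
suff E : map_poly (in_alg K) q - x%:P = 0.
  exists q`_0; move/eqP: E; rewrite subr_eq0 => /eqP/(congr1 (fun r : {poly K} => r`_0)).
  by rewrite coef_map coefC eqxx.
apply/eqP/negPn/negP => nz.
have := max_poly_roots nz (rs := [seq s u z | u <- enum {: {unit 'Z_n}}]).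
rewrite map_inj_uniq ?enum_uniq; last exact: conj_inj.
rewrite size_map -cardE card_conj ltnNge => /(_ _ isT)/negP; apply.
  apply/allP => _ /mapP[u _ ->]; rewrite rootE !hornerE subr_eq0 -(fx u) xq -horner_map.
  rewrite -map_poly_comp; apply/eqP; congr _.[_].
  by apply: eq_map_poly => a /=; rewrite alg_num_field fmorph_rat.
apply: leq_trans (size_polyD _ _) _; rewrite geq_max size_map_poly sz_q.
by rewrite size_polyN (leq_trans (size_polyC_leq1 _)) // totient_gt0 ltnW.
Qed.

Lemma conj_fixed_int (x : 'O_K) :
  (forall u, int_map (s u) x = x) -> exists m : int, x = m%:~R.
Proof.
move=> fx; have [|a xa] := @conj_fixed (val x); last exact: rat_alg_int xa.
by move=> u; rewrite -[in RHS](fx u).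
Qed.

Lemma norm_int (x : 'O_K) : exists m : int, \prod_u int_map (s u) x = m%:~R.
Proof.
apply: conj_fixed_int => u; rewrite rmorph_prod (reindex_inj (mulgI u^-1%g)) /=.
by apply: eq_bigr => v _; apply: val_inj; rewrite /= conjM mulVKg.
Qed.

Lemma trace_int (x : 'O_K) : exists m : int, \sum_u int_map (s u) x = m%:~R.
Proof.
apply: conj_fixed_int => u; rewrite rmorph_sum (reindex_inj (mulgI u^-1%g)) /=.
by apply: eq_bigr => v _; apply: val_inj; rewrite /= conjM mulVKg.
Qed.

End Conjugates.

(** * Generators of prime ideals *)

Section Comaximal.
Variable A : comNzRingType.
Implicit Types a b c : A.

Definition comaximal a b := exists u v, u * a + v * b = 1.

Lemma comaximal_mul a b c : comaximal a b -> comaximal a c -> comaximal a (b * c).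
Proof.
move=> [u [v uv]] [u' [v' uv']].
exists (u * (u' * a + v' * c) + v * b * u'), (v * v').
by rewrite -[RHS](mulr1 1) -{1}uv -uv'; ring.
Qed.

Lemma comaximal_prod (I : eqType) (r : seq I) (F : I -> A) a :
  {in r, forall i, comaximal a (F i)} -> comaximal a (\prod_(i <- r) F i).
Proof.
elim: r => [_|i r IHr Hr]; first by exists 0, 1; rewrite big_nil; ring.
rewrite big_cons; apply: comaximal_mul; first by apply: Hr; rewrite mem_head.
by apply: IHr => j jr; apply: Hr; rewrite inE jr orbT.
Qed.

(** Induction: multiply [c] by the Bezout relation between [F i] and the remaining product, and in
    each summand factor [c] by the other of the two. *)
Lemma comaximal_prod_dvd (I : eqType) (r : seq I) (F : I -> A) c :
  uniq r -> {in r &, forall i j, i != j -> comaximal (F i) (F j)} ->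
  {in r, forall i, exists d, c = d * F i} -> exists d, c = d * \prod_(i <- r) F i.
Proof.
elim: r => [*|i r IHr /= /andP[ir uniq_r] co dv]; first by exists c; rewrite big_nil mulr1.
have sub j : j \in r -> j \in i :: r by rewrite inE orbC => ->.
have [||d cd] := IHr uniq_r.
- by move=> j k jr kr; apply: co; apply: sub.
- by move=> j jr; apply/dv/sub.
have [d' cd'] : exists d, c = d * F i by apply: dv; rewrite mem_head.
have [u [v uv]] : comaximal (F i) (\prod_(j <- r) F j).
  apply: comaximal_prod => j jr; apply: co; rewrite ?mem_head ?sub //.
  by apply: contraNneq ir => ->.
exists (d * u + d' * v); rewrite big_cons -[LHS]mulr1 -[in LHS]uv mulrDr {1}cd cd'.
by ring.
Qed.

Lemma prime_ideal_prod (P : prime_idealr A) (I : eqType) (r : seq I) (F : I -> A) :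
  \prod_(i <- r) F i \in P -> exists2 i, i \in r & F i \in P.
Proof.
elim: r => [|i r IHr]; first by rewrite big_nil idealr1.
rewrite big_cons prime_idealrM => /orP[Fi|/IHr[j jr Fj]].
  by exists i; rewrite ?mem_head.
by exists j; rewrite // inE jr orbT.
Qed.

End Comaximal.

Section Integers.
Variables (K : fieldExtType rat).

(** The powers [w ^+ i], [i < n], sum to zero, so [n] is the sum of the [1 - w ^+ i], each a
    multiple of [1 - w]. *)
Lemma dvd_order_sub1 n (w : 'O_K) :
  w ^+ n = 1 -> w != 1 -> exists d, n%:R = d * (1 - w).
Proof.
move=> wn w1.
have sum0 : \sum_(i < n) w ^+ i = 0.
  have : (val w - 1) * val (\sum_(i < n) w ^+ i) = 0.
    by rewrite -[1]/(val (1 : 'O_K)) -rmorphB -rmorphM -subrX1 wn subrr.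
  move/eqP; rewrite mulf_eq0 subr_eq0 -[_ == 1]/(w == 1) (negPf w1) /= => /eqP E.
  exact: val_inj.
exists (\sum_(i < n) \sum_(j < i) w ^+ j).
have -> : n%:R = \sum_(i < n) 1 :> 'O_K by rewrite sumr_const card_ord.
apply: (@addIr _ (- \sum_(i < n) w ^+ i)); rewrite -sumrB sum0 subr0 mulr_suml.
by apply: eq_bigr => i _; rewrite -opprB subrX1 -mulNr opprB mulrC.
Qed.

Lemma intr_inj_field : injective (intr : int -> K).
Proof.
move=> a b ab; apply: (@intr_inj rat); apply: (fmorph_inj (in_alg K)).
by rewrite !rmorph_int.
Qed.

Lemma int_dvd_alg_int (m k : int) (c : 'O_K) :
  m != 0 -> k%:~R = c * m%:~R -> exists2 c' : int, c = c'%:~R & k = c' * m.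
Proof.
move=> m0 kcm.
have mK0 : (m%:~R : K) != 0 by rewrite -(inj_eq intr_inj_field) in m0.
have E : val c * m%:~R = k%:~R by rewrite -(rmorph_int (val : 'O_K -> K) m) -rmorphM -kcm rmorph_int.
have [|c' cc'] := @rat_alg_int K c (k%:~R / m%:~R).
  by rewrite -in_algE fmorph_div !rmorph_int -E mulfK.
exists c' => //; apply: intr_inj_field.
by rewrite intrM -E cc' rmorph_int.
Qed.

End Integers.

Section PrimeIdeal.
Variables (K : fieldExtType rat) (p n : nat) (P : prime_idealr 'O_K).
Hypotheses (p_pr : prime p) (pE : p = n.+1) (n_gt1 : (1 < n)%N) (hP : lies_over P p).

Lemma p_in_P : p%:R \in P.
Proof. by have := hP p; rewrite dvdzz => ->. Qed.

(* The ideal contains [r ^+ n - 1], the product of the [r - zeta ^+ k]. *)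
Lemma prime_ideal_root (zeta : 'O_K) (r : nat) :
  n.-primitive_root (val zeta) -> n.-primitive_root (r%:R : 'F_p) ->
  exists2 k, coprime k n & zeta ^+ k - r%:R \in P.
Proof.
move=> zn rn; have n_gt0 := ltnW n_gt1.
have modP m k : m%:R = k%:R :> 'F_p <-> (m%:R - k%:R : 'O_K) \in P.
  have := hP (m%:Z - k%:Z); rewrite rmorphB /= => ->.
  rewrite -eqz_mod_dvd !modz_nat; split=> [/(congr1 val)|/eqP[mk]].
    by rewrite /= !val_Fp_nat // => ->.
  by apply: val_inj; rewrite /= !val_Fp_nat.
have prodE : \prod_(0 <= k < n) (r%:R - zeta ^+ k) = (r ^ n)%:R - 1 :> 'O_K.
  apply: val_inj; rewrite rmorph_prod rmorphB rmorph_nat rmorph1 natrX.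
  have := congr1 (horner^~ r%:R) (factor_Xn_sub_1 zn); rewrite horner_prod !hornerE => <-.
  by apply: eq_bigr => k _; rewrite rmorphB rmorph_nat !hornerE rmorphXn.
have /prime_ideal_prod[k] : \prod_(0 <= k < n) (r%:R - zeta ^+ k) \in P.
  by rewrite prodE; apply/(modP _ 1%N); rewrite natrX prim_expr_order.
rewrite mem_index_iota /= => ltkn kP; have {}kP : zeta ^+ k - r%:R \in P by rewrite -opprB rpredN.
(* [(zeta ^+ k) ^+ m = 1] and [zeta ^+ k] is congruent to [r], so [r ^+ m = 1] in ['F_p]. Then [n]
   divides [m], which forces [gcdn k n = 1]. *)
exists k => //; pose m := (n %/ gcdn k n)%N.
have zkm : (zeta ^+ k) ^+ m = 1.
  apply: val_inj; rewrite !rmorphXn rmorph1 -exprM; apply/eqP.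
  by rewrite -(prim_order_dvd zn) /m muln_divA ?dvdn_gcdr // mulnC -muln_divA ?dvdn_gcdl // dvdn_mulr.
have : (n %| m)%N.
  rewrite (prim_order_dvd rn) -natrX; apply/eqP/esym/(modP 1).
  by rewrite natrX -[X in X - _]zkm subrXX mulrC idealMr.
rewrite -{1}[n](divnK (dvdn_gcdr k n)) -/m -{2}[m]muln1 dvdn_pmul2l ?dvdn1 //.
by rewrite divn_gt0 ?gcdn_gt0 ?n_gt0 ?orbT // dvdn_leq ?dvdn_gcdr.
Qed.

Variables (zeta : 'O_K) (s : {unit 'Z_n} -> {rmorphism K -> K}).
Hypotheses (zn : n.-primitive_root (val zeta)) (gen_z : <<1; val zeta>>%VS = fullv).
Hypothesis sz : forall u, s u (val zeta) = val zeta ^+ val u.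
Variables (r : nat) (x c d : 'O_K).
Hypotheses (xp : p%:R = c * x) (xr : zeta - r%:R = d * x).

Local Notation "x ^@ u" := (int_map (s u) x) (at level 30).

(** Modulo the two conjugates of [x], both [zeta ^+ u] and [zeta ^+ v] are congruent to [r], and
    their difference divides [n]. As [x ^@ u] divides [p], the ideal generated by the two conjugates
    contains [p - n = 1]. *)
Lemma conj_comaximal u v : u != v -> comaximal (x ^@ u) (x ^@ v).
Proof.
move=> uv.
have szO w : zeta ^@ w = zeta ^+ val w by apply: val_inj; rewrite rmorphXn -sz.
have xr' (w : {unit 'Z_n}) : zeta ^+ val w - r%:R = d ^@ w * x ^@ w.
  by rewrite -rmorphM -xr rmorphB rmorph_nat /= szO.
have lt_n (w : {unit 'Z_n}) : (val w <= n)%N.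
  by rewrite ltnW // (leq_trans (ltn_ord (val w))) // Zp_cast.
have zn1 : zeta ^+ n = 1 by apply: val_inj; rewrite rmorphXn rmorph1 prim_expr_order.
have zu1 : zeta ^+ val u * zeta ^+ (n - val u) = 1 by rewrite -exprD subnKC.
(* This root of unity is the quotient of [zeta ^+ v] by [zeta ^+ u]. *)
have [||e eE] := @dvd_order_sub1 K n (zeta ^+ (n - val u) * zeta ^+ val v).
- by rewrite exprMn -!exprM ![(_ * n)%N]mulnC !exprM zn1 !expr1n mulr1.
- apply: contra uv => /eqP/(congr1 (fun y => zeta ^+ val u * y)).
  rewrite mulrA zu1 mul1r mulr1 => /(congr1 val); rewrite !rmorphXn -!sz => E.
  by rewrite (conj_inj n_gt1 zn sz E).
pose e' := e * zeta ^+ (n - val u).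
have nE : n%:R = e' * (d ^@ u * x ^@ u - d ^@ v * x ^@ v).
  rewrite -!xr' eE /e' -{1}zu1; ring.
have pE' : p%:R = c ^@ u * x ^@ u by rewrite -rmorphM -xp rmorph_nat.
exists (c ^@ u - e' * d ^@ u), (e' * d ^@ v).
have -> : 1 = p%:R - n%:R :> 'O_K by rewrite pE -natr1 addrAC subrr add0r.
by rewrite pE' nE; ring.
Qed.

(* Choose [e = 1] modulo [x] and [e = 0] modulo the other conjugates of [x]; then the
   trace of [e * y] is a rational integer in [P], hence divisible by [p] and by [x],
   and it is congruent to [y] modulo [x]. *)
Lemma prime_ideal_generated : x \in P -> generates x P.
Proof.
move=> xP y; split=> [yP|[a ->]]; last exact: idealMr.
have [a [e ae]] : comaximal x (\prod_(u <- rem 1%g (enum {: {unit 'Z_n}})) x ^@ u).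
  apply: comaximal_prod => u; rewrite mem_rem_uniq ?enum_uniq // inE => /andP[u1 _].
  have x1 : x ^@ 1%g = x by apply: val_inj; rewrite /= (conj1 zn gen_z sz).
  rewrite -[X in comaximal X _]x1.
  by apply: conj_comaximal; rewrite eq_sym.
set e' := e * _ in ae.
(* For [u != 1], the product [e'] has the factor [x ^@ u^-1], which [u] sends to [x]. *)
have dvd_e u : u != 1%g -> exists t, e' ^@ u = t * x.
  move=> u1; rewrite /e' (big_rem u^-1%g) /=; last first.
    by rewrite mem_rem_uniq ?enum_uniq // inE mem_enum andbT invg_eq1.
  rewrite !rmorphM /=; have -> : x ^@ u^-1%g ^@ u = x.
    by apply: val_inj; rewrite /= (conjM n_gt1 zn gen_z sz) mulgV (conj1 zn gen_z sz).
  by rewrite mulrCA mulrC; eexists.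
have [m trE] := trace_int n_gt1 zn gen_z sz (e' * y).
have [t tE] : exists t, m%:~R = y + t * x.
  rewrite -trE (bigD1 1%g) //=.
  have -> : (e' * y) ^@ 1%g = y - a * y * x.
    have -> : (e' * y) ^@ 1%g = e' * y by apply: val_inj; rewrite /= (conj1 zn gen_z sz).
    by rewrite -[in RHS](mulr1 y) -{1}ae; ring.
  suff [t ->] : exists t, \sum_(u | u != 1%g) (e' * y) ^@ u = t * x.
    by exists (t - a * y); ring.
  elim/big_ind: _ => [|_ _ [t1 ->] [t2 ->]|u u1]; first by exists 0; rewrite mul0r.
    by exists (t1 + t2); ring.
  by have [t tE] := dvd_e u u1; exists (t * y ^@ u); rewrite rmorphM /= tE; ring.
have mP : m%:~R \in P by rewrite tE rpredD ?idealMr.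
move: mP; rewrite hP => /dvdzP[q qE].
exists (q%:~R * c - t); rewrite mulrBl -mulrA -xp.
by apply/eqP; rewrite eq_sym subr_eq -tE qE intrM.
Qed.

(** [p] divides [m] because the factor [x] puts [m] in [P]; [m] divides [p] because the conjugates
    are pairwise comaximal divisors of [p]. *)
Lemma norm_prime (m : int) :
  x \in P -> \prod_u x ^@ u = m%:~R -> `|m|%N = p.
Proof.
move=> xP mE; apply/eqP; rewrite eqn_dvd; apply/andP; split; last first.
  rewrite -[p in (p %| _)%N]absz_nat -dvdzE -hP -mE (bigD1 1%g) //= mulrC idealMr //.
  by have -> : x ^@ 1%g = x by apply: val_inj; rewrite /= (conj1 zn gen_z sz).
have [|||e eE] := @comaximal_prod_dvd _ _ (index_enum {unit 'Z_n}) (fun u => x ^@ u) p%:R.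
- exact: index_enum_uniq.
- by move=> u v _ _; apply: conj_comaximal.
- by move=> u _; exists (c ^@ u); rewrite -rmorphM -xp rmorph_nat.
have m0 : m != 0.
  apply/eqP => m0; move: eE; rewrite mE m0 mulr0 => /(congr1 val).
  rewrite rmorph_nat rmorph0 => /(@intr_inj_field K p 0)[p0].
  by move: p_pr; rewrite p0.
have [|q _ /(congr1 absz) /= ->] := @int_dvd_alg_int K m p e m0; first by rewrite -mE -eE.
by rewrite abszM dvdn_mull.
Qed.

End PrimeIdeal.

(** * Norms of large elements *)

(* [a^6 - 108 (a-1)^2 (a-2)^2 = (a^2 - 6a + 6)^2 ((a-2)^2 + 16(a-1))], the AM-GM
   inequality for [(a-2)^2], [2(a-1)], [2(a-1)], whose sum is [a^2]. *)
Lemma sqr_dist_le_expr6 (C : numDomainType) (a : C) :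
  1 <= a -> 108 * ((a - 1) ^+ 2 * (a - 2) ^+ 2) <= a ^+ 6.
Proof.
move=> a1; have aR : a \is Num.real by apply: ger1_real.
rewrite -subr_ge0.
have -> : a ^+ 6 - 108 * ((a - 1) ^+ 2 * (a - 2) ^+ 2) =
  (a ^+ 2 - 6 * a + 6) ^+ 2 * ((a - 2) ^+ 2 + 16 * (a - 1)) by ring.
have sqr_ge0 (b : C) : b \is Num.real -> 0 <= b ^+ 2 by move=> bR; rewrite real_exprn_even_ge0.
rewrite mulr_ge0 ?addr_ge0 ?sqr_ge0 ?mulr_ge0 ?subr_ge0 //.
  by rewrite rpredD ?rpredB ?rpredX ?rpredM ?realn.
by rewrite rpredB ?realn.
Qed.

Lemma norm_unity_root (C : numDomainType) n (w : C) : (0 < n)%N -> w ^+ n = 1 -> `|w| = 1.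
Proof. by move=> n_gt0 wn; apply/eqP; rewrite -(pexpr_eq1 n_gt0) // -normrX wn normr1. Qed.

Section Norm.
Variables (C : numClosedFieldType) (K : fieldExtType rat) (n : nat) (z : K).
Hypotheses (n_gt1 : (1 < n)%N) (zn : n.-primitive_root z) (gen_z : <<1; z>>%VS = fullv).
Variable s : {unit 'Z_n} -> {rmorphism K -> K}.
Hypothesis sz : forall u, s u z = z ^+ val u.

Lemma ex_embedding : exists sigma : {rmorphism K -> C}, True.
Proof.
have [w Phi_w] : exists w : C, root (map_poly ratr (ratPhi n)) w.
  apply/closed_rootP; rewrite size_map_poly size_ratPhi eqSS.
  by rewrite -lt0n totient_gt0 ltnW.
have [|f _] := ex_rmorph_root zn gen_z (ratr : {rmorphism rat -> C}) (w := w).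
  by rewrite -(map_ratPhi ratr).
by exists f.
Qed.

(** [z ^+ n.-1] is the inverse of [z], and complex conjugation inverts roots of unity; hence one [c]
    serves every [sigma]. *)
Lemma ex_complex_conj : exists c : {rmorphism K -> K},
  forall (sigma : {rmorphism K -> C}) x, sigma (c x) = (sigma x)^*.
Proof.
have n_gt0 := ltnW n_gt1.
have [|c cz] := ex_rmorph_root zn gen_z (in_alg K) (w := z ^+ n.-1).
  by apply: root_Cyclotomic; rewrite (prim_root_exp_coprime _ zn) coprimePn.
exists c => sigma x.
apply: (@eq_rmorph_prim _ _ _ zn gen_z _ (sigma \o c) (Num.conj \o sigma)) => /=.
have w1 : sigma z ^+ n = 1 by rewrite -rmorphXn prim_expr_order ?rmorph1.
have w0 : sigma z != 0 by rewrite fmorph_eq0 (prim_root_eq0 zn) -lt0n.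
apply: (mulfI w0); rewrite cz rmorphXn -exprS prednK // w1.
by rewrite -normCK (norm_unity_root n_gt0 w1) expr1n.
Qed.

Lemma large_norm_bound (x : 'O_K) (p : nat) (m : int) :
  prime p -> (2 < p)%N ->
  (forall sigma : {rmorphism K -> C}, 1 <= `|sigma (val x)|) ->
  \prod_u int_map (s u) x = m%:~R -> `|m|%N = p ->
  (108 ^ totient n <= p ^ 12)%N.
Proof.
move=> p_pr p_gt2 x_large mE mp.
have [sigma _] := ex_embedding; have [c cE] := ex_complex_conj.
have cE' u y : sigma (s u (c y)) = (sigma (s u y))^* by apply: (cE (sigma \o s u)).
pose a u := `|sigma (s u (val x))| ^+ 2.
have a_ge1 u : 1 <= a u by rewrite exprn_ege1 // (x_large (sigma \o s u)).
have prod_a : \prod_u a u = p%:R ^+ 2.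
  rewrite prodrXl -normr_prod; congr (_ ^+ 2).
  rewrite -rmorph_prod (_ : \prod_u _ = m%:~R) ?rmorph_int -?intr_norm -?mp //.
  by rewrite -(rmorph_int (val : 'O_K -> K)) -mE rmorph_prod.
(* The product of the [a u - k] is the norm of [x * int_map c x - k], an integer [t]; its square is
   at least 1 once [t] is nonzero. *)
have factor_ge1 (k : nat) : (0 < k < 3)%N -> 1 <= \prod_u (a u - k%:R) ^+ 2.
  move=> k_bnd; have [t tE] := norm_int n_gt1 zn gen_z sz (x * int_map c x - k%:R).
  have aE u : sigma (s u (val (x * int_map c x - k%:R))) = a u - k%:R.
    by rewrite !rmorphB !rmorph_nat !rmorphM /= cE' /a normCK.
  have prodE : \prod_u (a u - k%:R) = t%:~R.
    rewrite -(rmorph_int sigma) -(rmorph_int (val : 'O_K -> K)) -tE !rmorph_prod.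
    by apply: eq_bigr => u _; rewrite -aE.
  rewrite prodrXl prodE -rmorphXn ler1z.
  have : t != 0.
    apply/eqP => t0; move: prodE; rewrite t0 => /eqP/prodf_eq0[u _].
    rewrite -aE !fmorph_eq0 => /eqP xk.
    (* If the norm vanishes, every [a v] equals [k], so [p ^ 2] is a power of [k]. Then [p] divides
       [k], against [k < 3 <= p]. *)
    have ak v : a v = k%:R by apply/eqP; rewrite -subr_eq0 -aE xk !rmorph0.
    move: prod_a; under eq_bigr do rewrite ak.
    rewrite prodr_const -!natrX => /eqP; rewrite eqr_nat => /eqP kp.
    have : (p %| k ^ #|{: {unit 'Z_n}}|)%N by rewrite kp dvdn_mulr.
    rewrite Euclid_dvdX // => /andP[/dvdn_leq]; case/andP: k_bnd => -> k3 /(_ isT) pk.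
    by move: (leq_trans p_gt2 pk); rewrite ltnNge -ltnS k3.
  by rewrite -sqrf_eq0 -gtz0_ge1 lt0r => ->; rewrite sqr_ge0.
have : \prod_u (108 * ((a u - 1) ^+ 2 * (a u - 2) ^+ 2)) <= \prod_u (a u) ^+ 6.
  apply: ler_prod => u _; rewrite sqr_dist_le_expr6 // andbT.
  have sqr_ge0 (k : nat) : 0 <= (a u - k%:R) ^+ 2.
    by rewrite real_exprn_even_ge0 // rpredB ?realn // ger1_real.
  by rewrite mulr_ge0 // mulr_ge0 ?(sqr_ge0 1) ?sqr_ge0.
(* The product of the [a u] is [p ^ 2]; its sixth power gives the exponent 12. *)
rewrite big_split prodrXl prod_a prodr_const cardT -cardE (card_conj n_gt1) big_split /=.
rewrite -exprM -!natrX => le108.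
rewrite -(ler_nat C); apply: le_trans le108; rewrite -[leLHS]mulr1 ler_wpM2l //.
by rewrite -[leLHS]mulr1 ler_pM ?ler01 ?(factor_ge1 1) ?(factor_ge1 2).
Qed.

End Norm.

(** * Primitive roots and cyclotomic relations *)

Lemma ex_Fp_primitive_root p : prime p ->
  exists r : nat, (p.-1).-primitive_root (r%:R : 'F_p).
Proof.
move=> p_pr; have p1_gt0 : (0 < p.-1)%N by rewrite -subn1 subn_gt0 prime_gt1.
have [|||w _ wn] := hasP (@has_prim_root 'F_p p.-1 (enum (predC1 0)) p1_gt0 _ _ _).
- apply/allP => w; rewrite mem_enum inE => w0; apply/unity_rootP/(mulfI w0).
  by rewrite -exprS prednK ?prime_gt0 // mulr1; have := expf_card w; rewrite card_Fp.
- exact: enum_uniq.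
- by rewrite -cardE cardC1 card_Fp.
by exists w; rewrite natr_Zp.
Qed.

(** The order of [w] divides [n]. This form turns primitivity of a given residue into a finite
    computation. *)
Lemma primitive_root_divisors (F : nzRingType) n (w : F) :
  (0 < n)%N -> w ^+ n = 1 -> all (fun d => (d == n) || (w ^+ d != 1)) (divisors n) ->
  n.-primitive_root w.
Proof.
move=> n_gt0 wn /allP wd; have [m wm mn] := prim_order_exists n_gt0 wn.
have /wd : m \in divisors n by rewrite -dvdn_divisors.
by rewrite (prim_expr_order wm) eqxx orbF => /eqP <-.
Qed.

(* [f] is the value at [zeta] of a factor of ['X^n - 1] whose cofactor divides the product
   of the ['X^d - 1]. *)
Lemma prim_root_factor (K : fieldExtType rat) n (zeta : 'O_K) (ds : seq nat) (f h : 'O_K) :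
  n.-primitive_root (val zeta) -> all (fun d => 0 < d < n)%N ds ->
  f * \prod_(d <- ds) (zeta ^+ d - 1) = h * (zeta ^+ n - 1) -> f = 0.
Proof.
move=> zn /allP ds_n /(congr1 val).
have -> : val (h * (zeta ^+ n - 1)) = 0.
  by rewrite rmorphM rmorphB rmorphXn prim_expr_order // rmorph1 subrr mulr0.
rewrite rmorphM => /eqP; rewrite mulf_eq0 => /orP[/eqP ?|]; first exact: val_inj.
rewrite rmorph_prod prodf_seq_eq0 => /hasP[d /ds_n /andP[d_gt0 dn]].
rewrite rmorphB rmorphXn rmorph1 subr_eq0 -(prim_order_dvd zn) => /(dvdn_leq d_gt0).
by rewrite leqNgt dn.
Qed.

(** Reduces an equality modulo the relation [f = 0] to a polynomial identity for [ring], with the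
    multiplier [q] supplied by hand. *)
Lemma eq_mod0 (A : pzRingType) (f q a b : A) : f = 0 -> a = b + q * f -> a = b.
Proof. by move=> ->; rewrite mulr0 addr0. Qed.

(** * Criteria for a prime ideal over [p] to be large *)

Section Field.
Variables (R : realType) (p : nat) (K : fieldExtType rat) (P : prime_idealr 'O_K).
Hypotheses (p_pr : prime p) (p_gt2 : (2 < p)%N) (hK : cyclotomic_field p.-1 K)
  (hP : lies_over P p).

Let pE : p = p.-1.+1. Proof. by rewrite prednK // prime_gt0. Qed.
Let p1_gt1 : (1 < p.-1)%N. Proof. by rewrite -ltnS prednK // prime_gt0. Qed.

(** Replacing the given root of unity by a power lets [r] be chosen freely, so one explicit
    computation handles all [P] over [p]. *)
Lemma ex_zeta (r : nat) : (p.-1).-primitive_root (r%:R : 'F_p) ->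
  exists zeta : 'O_K, [/\ (p.-1).-primitive_root (val zeta),
    <<1; val zeta>>%VS = fullv & zeta - r%:R \in P].
Proof.
move=> rn; have [z zn gen_z] := hK.
have zO := unity_root_alg_int (ltnW p1_gt1) (prim_expr_order zn).
have [k kn kP] := @prime_ideal_root K p p.-1 P p_pr p1_gt1 hP (RingOfIntegers zO) r zn rn.
have zkn : (p.-1).-primitive_root (z ^+ k) by rewrite (prim_root_exp_coprime _ zn).
exists (RingOfIntegers zO ^+ k); rewrite rmorphXn; split=> //.
have [l zl] := prim_rootP zkn (prim_expr_order zn).
apply/eqP; rewrite eqEsubv subvf -gen_z; apply/FadjoinP; split; first exact: subv_adjoin.
by rewrite [X in X \in _]zl rpredX // memv_adjoin.
Qed.

Lemma large_ideal_bound : large_ideal R P -> (108 ^ totient p.-1 <= p ^ 12)%N.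
Proof.
case=> x xP x_large; have [r rn] := ex_Fp_primitive_root p_pr.
have [zeta [zn gen_z zr]] := ex_zeta rn.
have [s sz] := ex_conj p1_gt1 zn gen_z.
have [d dE] := (xP _).1 zr; have [c cE] := (xP _).1 (p_in_P hP).
have [m mE] := norm_int p1_gt1 zn gen_z sz x.
apply: (large_norm_bound p1_gt1 zn gen_z sz p_pr p_gt2 x_large mE).
apply: (norm_prime p_pr pE p1_gt1 hP zn gen_z sz cE dE _ mE).
by apply/xP; exists 1; rewrite mul1r.
Qed.

(** A certificate that [x] generates [P]: [a] and [b] put [x] in [P], while [c] and [d] show that
    [x] divides [p] and [zeta - r]. *)
Lemma large_ideal_cofactors (r : nat) (zeta x a b c d : 'O_K) :
  (p.-1).-primitive_root (val zeta) -> <<1; val zeta>>%VS = fullv ->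
  zeta - r%:R \in P -> x = a * (zeta - r%:R) + b * p%:R ->
  p%:R = c * x -> zeta - r%:R = d * x -> large_elt R x -> large_ideal R P.
Proof.
move=> zn gen_z zr xE xp xr x_large; have [s sz] := ex_conj p1_gt1 zn gen_z.
exists x => //; apply: (prime_ideal_generated pE p1_gt1 hP zn gen_z sz xp xr).
by rewrite xE rpredD ?idealMr ?(p_in_P hP).
Qed.

Variable zeta : 'O_K.
Hypothesis zn : (p.-1).-primitive_root (val zeta).

Let norm_zeta (sigma : {rmorphism K -> R[i]}) : `|sigma (val zeta)| = 1.
Proof.
apply: (norm_unity_root (ltnW p1_gt1)).
by rewrite -rmorphXn prim_expr_order ?rmorph1.
Qed.

Lemma large_2B : large_elt R (2%:R - zeta).
Proof.
move=> sigma; rewrite rmorphB !rmorph_nat.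
by apply: le_trans (lerB_dist _ _); rewrite norm_zeta normr_nat lerBrDr lexx.
Qed.

Lemma large_2D : large_elt R (2%:R + zeta).
Proof.
move=> sigma; rewrite rmorphD !rmorph_nat.
by apply: le_trans (lerB_normD _ _); rewrite norm_zeta normr_nat lerBrDr lexx.
Qed.

(* [|1 + w - w^2|^2 = 1 + |1 - w^2|^2] on the unit circle. *)
Lemma large_1DB : large_elt R (1 + zeta - zeta ^+ 2).
Proof.
move=> sigma; rewrite -(ler_pXn2r (n := 2)) ?nnegrE // expr1n.
rewrite !(rmorphB, rmorphD, rmorphXn, rmorph1) /=; set w := sigma _.
suff -> : `|1 + w - w ^+ 2| ^+ 2 = 1 + `|1 - w ^+ 2| ^+ 2.
  by rewrite lerDl exprn_ge0.
have ww : w * w^* - 1 = 0 by rewrite -normCK norm_zeta expr1n subrr.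
rewrite !normCK !(rmorphB, rmorphD, rmorphXn, rmorph1) /=.
by apply: (eq_mod0 (q := - w - w^* + 1) ww); set v := w^*; ring.
Qed.

End Field.

(** * Explicit generators *)

Lemma expn_bounds p : p \in [:: 17; 23; 29; 37; 41; 43; 61; 67; 71]%N ->
  (p ^ 12 < 108 ^ totient p.-1)%N.
Proof.
(* Factoring the exponents leaves the small comparison [17 ^ 3 < 108 ^ 2]. *)
rewrite in_cons; case/predU1P => [->|].
  have [t16 e12] : totient 16 = (2 * 4)%N /\ (12 = 3 * 4)%N by [].
  by rewrite t16 e12 !expnM ltn_exp2r.
(* Here [23 < 27], and after cancelling [27 ^ 10] it remains that [27 ^ 2 <= 4 ^ 10]. *)
rewrite in_cons; case/predU1P => [->|p_in].
  have [t22 e12] : totient 22 = (5 * 2)%N /\ (12 = 5 * 2 + 2)%N by [].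
  apply: (@leq_trans (27 ^ 12)); first by rewrite ltn_exp2r.
  have -> : (108 = 27 * 4)%N by [].
  by rewrite t22 e12 expnMn expnD leq_pmul2l ?expn_gt0 // [leqRHS]expnM leq_exp2r.
have /andP[p_lt t_ge] : (p < 108)%N && (12 <= totient p.-1)%N.
  by move: p p_in; apply/allP; vm_compute.
by apply: (@leq_trans (108 ^ 12)); rewrite ?ltn_exp2r ?leq_pexp2l.
Qed.

Section ExplicitGenerators.
Variables (R : realType) (K : fieldExtType rat) (P : prime_idealr 'O_K).

Ltac primitive_root_Fp := apply: primitive_root_divisors;
  [ by [] | by apply/eqP; vm_compute | by vm_compute ].

(** The value of ['Phi_4] at 2 is 5, so 5 is a multiple of [2 - zeta]. Likewise ['Phi_10] and
    ['Phi_12] take the values 11 and 13 at 2. *)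
Lemma large_ideal5 : cyclotomic_field 4 K -> lies_over P 5 -> large_ideal R P.
Proof.
move=> hK hP; have rp : 4.-primitive_root (2%:R : 'F_5) by primitive_root_Fp.
have [zeta [zn gen_z zr]] := ex_zeta (p := 5) isT isT hK hP rp.
have Phi : zeta ^+ 2 + 1 = 0.
  by apply: (@prim_root_factor _ _ _ [:: 2] _ 1 zn) => //; rewrite unlock /=; ring.
apply: (large_ideal_cofactors (p := 5) (a := - 1) (b := 0) (c := 2%:R + zeta) (d := - 1)
  isT isT hP zn gen_z zr _ _ _ (large_2B (p := 5) isT isT zn)).
- ring.
- by apply: (eq_mod0 (q := 1) Phi); ring.
- ring.
Qed.

(** The value of ['Phi_6] at -2 is 7, and [r = 5] is -2 modulo 7. *)
Lemma large_ideal7 : cyclotomic_field 6 K -> lies_over P 7 -> large_ideal R P.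
Proof.
move=> hK hP; have rp : 6.-primitive_root (5%:R : 'F_7) by primitive_root_Fp.
have [zeta [zn gen_z zr]] := ex_zeta (p := 7) isT isT hK hP rp.
have Phi : zeta ^+ 2 - zeta + 1 = 0.
  (* The list consists of the quotients of 6 by its prime divisors; the cofactor is what remains in
     the Möbius product for ['Phi_6]. *)
  apply: (@prim_root_factor _ _ _ [:: 2; 3] _ (zeta - 1) zn) => //.
  by rewrite unlock /=; ring.
apply: (large_ideal_cofactors (p := 7) (a := 1) (b := 1) (c := 3%:R - zeta) (d := zeta - 2%:R)
  isT isT hP zn gen_z zr _ _ _ (large_2D (p := 7) isT isT zn)).
- ring.
- by apply: (eq_mod0 (q := 1) Phi); ring.
- by apply: (eq_mod0 (q := - 1) Phi); ring.
Qed.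

Lemma large_ideal11 : cyclotomic_field 10 K -> lies_over P 11 -> large_ideal R P.
Proof.
move=> hK hP; have rp : 10.-primitive_root (2%:R : 'F_11) by primitive_root_Fp.
have [zeta [zn gen_z zr]] := ex_zeta (p := 11) isT isT hK hP rp.
have Phi : zeta ^+ 4 - zeta ^+ 3 + zeta ^+ 2 - zeta + 1 = 0.
  apply: (@prim_root_factor _ _ _ [:: 2; 5] _ (zeta - 1) zn) => //.
  by rewrite unlock /=; ring.
apply: (large_ideal_cofactors (p := 11) (a := - 1) (b := 0)
  (c := zeta ^+ 3 + zeta ^+ 2 + 3%:R * zeta + 5%:R) (d := - 1)
  isT isT hP zn gen_z zr _ _ _ (large_2B (p := 11) isT isT zn)).
- ring.
- by apply: (eq_mod0 (q := 1) Phi); ring.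
- ring.
Qed.

Lemma large_ideal13 : cyclotomic_field 12 K -> lies_over P 13 -> large_ideal R P.
Proof.
move=> hK hP; have rp : 12.-primitive_root (2%:R : 'F_13) by primitive_root_Fp.
have [zeta [zn gen_z zr]] := ex_zeta (p := 13) isT isT hK hP rp.
have Phi : zeta ^+ 4 - zeta ^+ 2 + 1 = 0.
  apply: (@prim_root_factor _ _ _ [:: 4; 6] _ (zeta ^+ 2 - 1) zn) => //.
  by rewrite unlock /=; ring.
apply: (large_ideal_cofactors (p := 13) (a := - 1) (b := 0)
  (c := zeta ^+ 3 + 2%:R * zeta ^+ 2 + 3%:R * zeta + 6%:R) (d := - 1)
  isT isT hP zn gen_z zr _ _ _ (large_2B (p := 13) isT isT zn)).
- ring.
- by apply: (eq_mod0 (q := 1) Phi); ring.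
- ring.
Qed.

(** The primitive root 15 is a zero of [1 + X - X^2] modulo 19: the value is [-11 * 19]. Division by
    [X - 15] gives [a] and [b]; [c] and [d] are the quotients of 19 and [zeta - 15] by [x]. *)
Lemma large_ideal19 : cyclotomic_field 18 K -> lies_over P 19 -> large_ideal R P.
Proof.
move=> hK hP; have rp : 18.-primitive_root (15%:R : 'F_19) by primitive_root_Fp.
have [zeta [zn gen_z zr]] := ex_zeta (p := 19) isT isT hK hP rp.
have Phi : zeta ^+ 6 - zeta ^+ 3 + 1 = 0.
  apply: (@prim_root_factor _ _ _ [:: 6; 9] _ (zeta ^+ 3 - 1) zn) => //.
  by rewrite unlock /=; ring.
apply: (large_ideal_cofactors (p := 19) (a := - zeta - 14%:R) (b := - 11%:R)
  (c := - (6%:R * zeta ^+ 5) + 5%:R * zeta ^+ 4 - zeta ^+ 3 + 10%:R * zeta ^+ 2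
    - 2%:R * zeta + 8%:R)
  (d := 5%:R * zeta ^+ 5 - 4%:R * zeta ^+ 4 + zeta ^+ 3 - 8%:R * zeta ^+ 2
    + 2%:R * zeta - 6%:R)
  isT isT hP zn gen_z zr _ _ _ (large_1DB (p := 19) isT isT zn)).
- ring.
- by apply: (eq_mod0 (q := 11%:R - 6%:R * zeta) Phi); ring.
- by apply: (eq_mod0 (q := 5%:R * zeta - 9%:R) Phi); ring.
Qed.

(** At the primitive root 13 modulo 31, [1 + X - X^2] takes the value [-5 * 31]. *)
Lemma large_ideal31 : cyclotomic_field 30 K -> lies_over P 31 -> large_ideal R P.
Proof.
move=> hK hP; have rp : 30.-primitive_root (13%:R : 'F_31) by primitive_root_Fp.
have [zeta [zn gen_z zr]] := ex_zeta (p := 31) isT isT hK hP rp.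
have Phi : zeta ^+ 8 + zeta ^+ 7 - zeta ^+ 5 - zeta ^+ 4 - zeta ^+ 3 + zeta + 1 = 0.
  apply: (@prim_root_factor _ _ _ [:: 6; 10; 15] _
    ((zeta + 1) * (zeta ^+ 3 - 1) * (zeta ^+ 5 - 1)) zn) => //.
  by rewrite unlock /=; ring.
apply: (large_ideal_cofactors (p := 31) (a := - zeta - 12%:R) (b := - 5%:R)
  (c := - (25%:R * zeta ^+ 7) - 9%:R * zeta ^+ 6 + 7%:R * zeta ^+ 5 + 23%:R * zeta ^+ 4
    + 14%:R * zeta ^+ 3 + 21%:R * zeta ^+ 2 - 6%:R * zeta - 10%:R)
  (d := 11%:R * zeta ^+ 7 + 4%:R * zeta ^+ 6 - 3%:R * zeta ^+ 5 - 10%:R * zeta ^+ 4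
    - 6%:R * zeta ^+ 3 - 9%:R * zeta ^+ 2 + 3%:R * zeta + 5%:R)
  isT isT hP zn gen_z zr _ _ _ (large_1DB (p := 31) isT isT zn)).
- ring.
- by apply: (eq_mod0 (q := 41%:R - 25%:R * zeta) Phi); ring.
- by apply: (eq_mod0 (q := 11%:R * zeta - 18%:R) Phi); ring.
Qed.

End ExplicitGenerators.

Theorem theorem5p1 (R : realType) (p : nat)
    (hp : p \in [:: 5; 7; 11; 13; 17; 19; 23; 29; 31; 37; 41; 43; 61; 67; 71]%N)
    (K : fieldExtType rat) (hK : cyclotomic_field p.-1 K)
    (P : prime_idealr 'O_K) (hP : lies_over P p) :
  large_ideal R P <-> p \in [:: 5; 7; 11; 13; 19; 31]%N.
Proof.
split=> [P_large|].
  have /andP[p_pr p_gt2] : prime p && (2 < p)%N.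
    by move: p hp {hK hP}; apply/allP.
  have := large_ideal_bound p_pr p_gt2 hK hP P_large.
  apply: contraTT => p_notin; rewrite -ltnNge expn_bounds //.
  by move: p_notin; apply/implyP; move: p hp {hK hP p_pr p_gt2}; apply/allP.
move=> p_in; move: p_in hK hP {hp}; rewrite !inE.
case/predU1P => [->|]; first exact: large_ideal5.
case/predU1P => [->|]; first exact: large_ideal7.
case/predU1P => [->|]; first exact: large_ideal11.
case/predU1P => [->|]; first exact: large_ideal13.
case/predU1P => [->|/eqP ->]; [exact: large_ideal19 | exact: large_ideal31].
Qed.
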